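(* The finite category $\mathbb{A}$ is not of type (FP$_R$) for any associative, commutative ring $R$ with identity.
   Context: $\mathbb{A}$ is the category with four objects $a_1,a_2,a_3,a_4$ and morphism sets $\mathrm{mor}(a_1,a_1)=\{\mathrm{id},f_{11}\}$, $\mathrm{mor}(a_1,a_2)=\{f_{12},g_{12}\}$, $\mathrm{mor}(a_1,a_3)=\{f_{13}\}$, $\mathrm{mor}(a_1,a_4)=\{f_{14}\}$, $\mathrm{mor}(a_2,a_1)=\{f_{21},g_{21}\}$, $\mathrm{mor}(a_2,a_2)=\{\mathrm{id},f_{22}\}$, $\mathrm{mor}(a_2,a_3)=\{f_{23}\}$, $\mathrm{mor}(a_2,a_4)=\{f_{24},g_{24}\}$, $\mathrm{mor}(a_3,a_1)=\{f_{31}\}$, $\mathrm{mor}(a_3,a_2)=\{f_{32}\}$, $\mathrm{mor}(a_3,a_3)=\{\mathrm{id}=f_{33}\}$, $\mathrm{mor}(a_3,a_4)=\{f_{34}\}$, $\mathrm{mor}(a_4,a_4)=\{\mathrm{id}=f_{44}\}$, and $\mathrm{mor}(a_4,a_j)=\emptyset$ for $j\ne4$. Composition: for non-identity morphisms $p\colon a_i\to a_j$ and $q\colon a_j\to a_k$, $q\circ p=f_{ik}$. For a small category $\Gamma$, an $R\Gamma$-module is a functor $\Gamma^{op}\to R\text{-Mod}$ (morphisms: natural transformations; exactness objectwise). $R\,\mathrm{mor}(?,x)$ sends $y$ to the free $R$-module on $\mathrm{mor}(y,x)$. A finitely generated projective $R\Gamma$-module is a direct summand of a finite direct sum of such modules.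 $\Gamma$ is of type (FP$_R$) if the constant $R\Gamma$-module $\underline{R}$ with value $R$ has a resolution with finitely many nonzero terms, all finitely generated projective.
   Formalization: The ring R is assumed to be nonzero: over the zero ring every module is zero, so the constant module has the zero resolution and the category is of type (FP_R). *)

(* Defs.v *)
From HB Require Import structures.
From mathcomp Require Import all_boot all_order all_algebra.
From mathcomp Require Import finmap monalg.

Set Implicit Arguments.
Unset Strict Implicit.
Unset Printing Implicit Defensive.

Import GRing.Theory.
Local Open Scope ring_scope.

(* Morphism sets are [choiceType]s so that MathComp's free modules            *)
(* [{malg R[K]}] apply to them. Composition is in applicative order:          *)
(* [compm q p] is q after p.                                                  *)
Record category := Category {
  ob :> Type;
  mor : ob -> ob -> choiceType;
  idm : forall x, mor x x;
  compm : forall x y z, mor y z -> mor x y -> mor x z;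
  comp_idl : forall x y (p : mor x y), compm (idm y) p = p;
  comp_idr : forall x y (p : mor x y), compm p (idm x) = p;
  comp_assoc : forall x y z w (r : mor z w) (q : mor y z) (p : mor x y),
    compm r (compm q p) = compm (compm r q) p }.
Arguments mor {c} x y.
Arguments idm {c} x.
Arguments compm {c x y z} q p.

Section Modules.
Variables (R : comNzRingType) (C : category).

(* Contravariant functors from C to R-modules. *)
Record rmodule := RModule {
  val_at :> C -> lmodType R;
  act : forall x y, mor x y -> {linear val_at y -> val_at x};
  act_id : forall x (m : val_at x), act (idm x) m = m;
  act_comp : forall x y z (q : mor y z) (p : mor x y) (m : val_at z),
    act (compm q p) m = act p (act q m) }.

Record rmod_hom (M N : rmodule) := RModHom {
  hom_at :> forall x, {linear M x -> N x};
  hom_nat : forall x y (p : mor x y) (m : M y),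
    hom_at x (act M p m) = act N p (hom_at y m) }.

Definition rmod_iso (M N : rmodule) : Prop :=
  exists (u : rmod_hom M N) (v : rmod_hom N M),
    forall x, cancel (u x) (v x) /\ cancel (v x) (u x).

Definition rmod_is_zero (M : rmodule) : Prop := forall x (m : M x), m = 0.

Definition rmod_epi (M N : rmodule) (u : rmod_hom M N) : Prop :=
  forall x (n : N x), exists m : M x, u x m = n.

(* Exactness of L -> M -> N at M. *)
Definition rmod_exact (L M N : rmodule)
    (u : rmod_hom L M) (v : rmod_hom M N) : Prop :=
  forall x (m : M x), v x m = 0 <-> exists l : L x, u x l = m.

Definition const_rmod : rmodule :=
  @RModule (fun=> GRing.Lmodule.clone R R^o _) (fun _ _ _ => idfun)
    (fun _ _ => erefl) (fun _ _ _ _ _ _ => erefl).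

Definition zero_rmod : rmodule :=
  @RModule (fun=> GRing.Lmodule.clone R 'rV[R]_0 _) (fun _ _ _ => idfun)
    (fun _ _ => erefl) (fun _ _ _ _ _ _ => erefl).

Section DirectSum.
Variables M N : rmodule.

Definition dsum_act x y (p : mor x y) (m : (M y * N y)%type) :
    (M x * N x)%type :=
  (act M p m.1, act N p m.2).

Fact dsum_act_is_linear x y (p : mor x y) : linear (dsum_act p).
Proof. by move=> a u v; rewrite /dsum_act /= !linearP. Qed.
HB.instance Definition _ x y (p : mor x y) :=
  GRing.isLinear.Build R (M y * N y)%type (M x * N x)%type _ (dsum_act p)
    (dsum_act_is_linear p).

Fact dsum_act_id x m : dsum_act (idm x) m = m.
Proof. by case: m => m n; rewrite /dsum_act /= !act_id. Qed.

Fact dsum_act_comp x y z (q : mor y z) (p : mor x y) m :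
  dsum_act (compm q p) m = dsum_act p (dsum_act q m).
Proof. by rewrite /dsum_act /= !act_comp. Qed.

Definition dsum_rmod : rmodule :=
  @RModule (fun x => GRing.Lmodule.clone R (M x * N x)%type _)
    (fun x y p => dsum_act p) dsum_act_id dsum_act_comp.

End DirectSum.

Section Representable.
Variable x : C.

(* The linear extension of precomposition u |-> u o p on basis elements. *)
Definition rep_act y z (p : mor y z) (a : {malg R[mor z x]}) :
    {malg R[mor y x]} :=
  \sum_(u <- msupp a) a@_u *: << compm u p >>.

Fact rep_actEw y z (p : mor y z) (a : {malg R[mor z x]})
    (d : {fset mor z x}) : (msupp a `<=` d)%fset ->
  rep_act p a = \sum_(u <- d) a@_u *: << compm u p >>.
Proof.
move=> sad; rewrite /rep_act; apply: big_fset_incl => // u _ /mcoeff_outdom ->.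
by rewrite scale0r.
Qed.

Fact rep_act_is_linear y z (p : mor y z) : linear (rep_act p).
Proof.
move=> c a b; pose d := (msupp a `|` msupp b `|` msupp (c *: a + b))%fset.
have [sa sb sc] : [/\ msupp a `<=` d, msupp b `<=` d
    & msupp (c *: a + b) `<=` d]%fset.
  by split; apply/fsubsetP => u; rewrite !inE => ->; rewrite ?orbT.
rewrite (rep_actEw p sa) (rep_actEw p sb) (rep_actEw p sc).
rewrite scaler_sumr -big_split /=; apply: eq_bigr => u _.
by rewrite mcoeffD mcoeffZ scalerDl scalerA.
Qed.
HB.instance Definition _ y z (p : mor y z) :=
  GRing.isLinear.Build R {malg R[mor z x]} {malg R[mor y x]} _ (rep_act p)
    (rep_act_is_linear p).

Fact rep_actU y z (p : mor y z) (u : mor z x) :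
  rep_act p << u >> = << compm u p >>.
Proof.
rewrite (@rep_actEw _ _ p _ [fset u]%fset) ?msuppU_le //.
by rewrite big_seq_fset1 mcoeffUU scale1r.
Qed.

Fact rep_act_id y a : rep_act (idm y) a = a.
Proof.
rewrite [RHS]monalgE; apply: eq_bigr => u _; rewrite comp_idr.
by apply/malgP => v; rewrite mcoeffZ !mcoeffU mulr_natr.
Qed.

Fact rep_act_comp w y z (q : mor y z) (p : mor w y) a :
  rep_act (compm q p) a = rep_act p (rep_act q a).
Proof.
rewrite [rep_act q a]/rep_act linear_sum; apply: eq_bigr => u _.
by rewrite linearZ /= rep_actU comp_assoc.
Qed.

(* The module R mor(?, x). *)
Definition rep_rmod : rmodule :=
  @RModule (fun y => GRing.Lmodule.clone R {malg R[mor y x]} _)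
    (fun y z p => rep_act p) rep_act_id rep_act_comp.

End Representable.

(* The direct sum of the modules R mor(?, x), x in s (with multiplicity). *)
Definition fg_free_rmod (s : seq C) : rmodule :=
  foldr (fun x M => dsum_rmod (rep_rmod x) M) zero_rmod s.

Definition fg_projective (P : rmodule) : Prop :=
  exists (Q : rmodule) (s : seq C), rmod_iso (dsum_rmod P Q) (fg_free_rmod s).

Definition type_FP : Prop :=
  exists (P : nat -> rmodule)
         (d : forall n, rmod_hom (P n.+1) (P n))
         (e : rmod_hom (P 0) const_rmod),
    [/\ forall n, fg_projective (P n),
        exists N, forall n, (N <= n)%N -> rmod_is_zero (P n),
        rmod_epi e,
        rmod_exact (d 0) e
      & forall n, rmod_exact (d n.+1) (d n)].

End Modules.

Arguments type_FP : clear implicits.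

Inductive obA := a1 | a2 | a3 | a4.

(* A morphism a_i -> a_j is a label occurring in [labels a_i a_j]. The label  *)
(* [lid] is the identity, [lf] is f_ij and [lg] is g_ij; for i = j = 3, 4,     *)
(* where id = f_ii, the only label is [lid].                                  *)
Inductive label := lid | lf | lg.

Definition nat_of_label (l : label) : nat :=
  match l with lid => 0 | lf => 1 | lg => 2 end.
Definition label_of_nat (n : nat) : option label :=
  match n with 0 => Some lid | 1 => Some lf | 2 => Some lg | _ => None end.
Fact nat_of_labelK : pcancel nat_of_label label_of_nat.
Proof. by case. Qed.
HB.instance Definition _ := Countable.copy label (pcan_type nat_of_labelK).

Definition labels (i j : obA) : seq label :=
  match i, j with
  | a1, a1 => [:: lid; lf]
  | a1, a2 => [:: lf; lg]
  | a1, a3 => [:: lf]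
  | a1, a4 => [:: lf]
  | a2, a1 => [:: lf; lg]
  | a2, a2 => [:: lid; lf]
  | a2, a3 => [:: lf]
  | a2, a4 => [:: lf; lg]
  | a3, a1 => [:: lf]
  | a3, a2 => [:: lf]
  | a3, a3 => [:: lid]
  | a3, a4 => [:: lf]
  | a4, a4 => [:: lid]
  | a4, _ => [::]
  end.

Definition morA (i j : obA) : choiceType :=
  Choice.clone {l : label | l \in labels i j} _.

Definition idA_label (i : obA) : lid \in labels i i :=
  match i with a1 | a2 | a3 | a4 => isT end.
Definition idA (i : obA) : morA i i := Sub lid (idA_label i).

(* The label of f_ik. *)
Definition f_label (i k : obA) : label :=
  match i, k with
  | a3, a3 | a4, a4 => lid
  | _, _ => lf
  end.

Definition comp_label (i k : obA) (q p : label) : label :=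
  match p, q with
  | lid, _ => q
  | _, lid => p
  | _, _ => f_label i k
  end.

Fact comp_labelP i j k (q : morA j k) (p : morA i j) :
  comp_label i k (val q) (val p) \in labels i k.
Proof.
by case: i j k q p => [] [] [] [[] //= ?] [[] //= ?].
Qed.

Definition compA i j k (q : morA j k) (p : morA i j) : morA i k :=
  Sub (comp_label i k (val q) (val p)) (comp_labelP q p).

Fact compA_idl i j (p : morA i j) : compA (idA j) p = p.
Proof. by apply: val_inj; case: p => [[]]. Qed.

Fact compA_idr i j (p : morA i j) : compA p (idA i) = p.
Proof. by apply: val_inj; case: p => [[]]. Qed.

Fact compA_assoc i j k l (r : morA k l) (q : morA j k) (p : morA i j) :
  compA r (compA q p) = compA (compA r q) p.
Proof.
apply: val_inj.
by case: i j k l r q p => [] [] [] [] [[] //= ?] [[] //= ?] [[] //= ?].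
Qed.

Definition category_A : category :=
  Category compA_idl compA_idr compA_assoc.

(* Main.v *)
From HB Require Import structures.
Require Import Defs.
From mathcomp Require Import all_boot all_order all_algebra.
From mathcomp Require Import finmap monalg ring.

(** A composite of two non-identity morphisms depends on its end points only,
    so the differences g_ij - f_ij compose to zero with each other and with
    the other non-identity morphisms. Hence the restriction maps of a module M
    along g12 - f12, g21 - f21, g24 - f24, f31 and f32 assemble into an
    endomorphism D of the sum
      M(a1) + M(a2) + M(a3) + M(a3) + M(a4)
    with D o D = 0 ([total], [total_d]). This differential module is an exact
    functor of M.

    The objects a1 and a2 both retract onto a3, and so the components f31 and
    f32 of D cut M(a1) and M(a2) down to the kernels of f11 and f22. On these
    kernels g12 - f12 and g21 - f21 alternate. This mirrors the projective
    resolution of the constant module, which is two-periodic, hence infinite,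
    from the kernel of R mor(?, a4) -> R onwards. The summand M(a4), mapped by
    g24 - f24, makes the differential module of R mor(?, a4) acyclic too.

    For each R mor(?, x) a contracting homotopy can be written down
    ([rep1_homotopyP] to [rep4_homotopyP]), so the differential module of any
    finitely generated projective module is acyclic. Acyclicity passes from
    the terms of a finite resolution to the resolved module
    ([acyclic_resolved]). But for the constant module the two restrictions in
    each difference agree, and 1 in M(a4) is a cycle which is no boundary,
    since no component of D ends in M(a4). *)

Set Implicit Arguments.
Unset Strict Implicit.
Unset Printing Implicit Defensive.

Import GRing.Theory.
Local Open Scope ring_scope.

(** * Acyclic differential groups *)

Definition acyclic (X : zmodType) (D : X -> X) : Prop :=
  forall z, D z = 0 -> exists w, D w = z.

Lemma acyclic_retract (X Y : zmodType) (DX : X -> X) (DY : Y -> Y)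
    (u : {additive X -> Y}) (v : {additive Y -> X}) :
  (forall z, u (DX z) = DY (u z)) -> (forall z, v (DY z) = DX (v z)) ->
  cancel u v -> acyclic DY -> acyclic DX.
Proof.
move=> uD vD uK acY z Dz.
have [w wE] : exists w, DY w = u z by apply: acY; rewrite -uD Dz raddf0.
by exists (v w); rewrite -vD wE uK.
Qed.

(** The homotopy is an arbitrary map: subtracting its value at 0 makes up for
    the absence of additivity. *)
Lemma acyclic_homotopy (X : zmodType) (D : {additive X -> X}) (h : X -> X) :
  (forall z, D (h z) + h (D z) = z) -> acyclic D.
Proof.
move=> hP z Dz; exists (h z - h 0).
have h0 : h 0 = - D (h 0).
  by apply/eqP; rewrite -addr_eq0 addrC -{2}(raddf0 D) hP.
by rewrite raddfB -h0 -Dz hP.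
Qed.

Section FiniteResolution.
Variables (X : nat -> zmodType) (Y : zmodType).
Variables (D : forall n, {additive X n -> X n}) (DY : Y -> Y).
Variables (d : forall n, {additive X n.+1 -> X n}) (e : {additive X 0 -> Y}).
Hypothesis D2 : forall n z, D n (D n z) = 0.
Hypothesis dD : forall n z, d n (D n.+1 z) = D n (d n z).
Hypothesis eD : forall z, e (D 0 z) = DY (e z).
Hypothesis e_onto : forall y, exists z, e z = y.
Hypothesis e_exact : forall z, e z = 0 <-> exists w, d 0 w = z.
Hypothesis d_exact : forall n z, d n z = 0 <-> exists w, d n.+1 w = z.
Hypothesis X_bounded : exists N, forall n, (N <= n)%N -> forall z : X n, z = 0.
Hypothesis X_acyclic : forall n, acyclic (D n).

(** This is acyclicity of the image of [d n]. It holds trivially for large n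
    and descends from n.+1 to n: the kernel of [X n.+1 -> X n] is the next
    image, and a quotient of an acyclic differential group by an acyclic
    subgroup is acyclic. *)
Lemma acyclic_syzygy n z : D n (d n z) = 0 -> exists w, D n (d n w) = d n z.
Proof.
have [N XN] := X_bounded.
have [k leNk] : exists k, (N <= n.+1 + k)%N by exists N; rewrite leq_addl.
elim: k n z leNk => [|k IHk] n z leNk Ddz.
  by exists 0; rewrite (XN n.+1 _ z) ?raddf0 //; rewrite addn0 in leNk.
have /d_exact[z' z'E] : d n (D n.+1 z) = 0 by rewrite dD.
have [||w wE] := IHk n.+1 z'; first by rewrite addSnnS.
  by rewrite z'E D2.
(* [D z] is the boundary of a point of the kernel, so subtracting that point
   turns [z] into a cycle with the same image. *)
have /X_acyclic[w' w'E] : D n.+1 (z - d n.+1 w) = 0.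
  by rewrite raddfB wE z'E subrr.
have ddw : d n (d n.+1 w) = 0 by apply/d_exact; exists w.
by exists w'; rewrite -dD w'E raddfB ddw subr0.
Qed.

Lemma acyclic_resolved : acyclic DY.
Proof.
move=> y; have [z <-] := e_onto y; rewrite -eD => /e_exact[z' z'E].
have [|w wE] := @acyclic_syzygy 0 z'; first by rewrite z'E D2.
have /X_acyclic[w' w'E] : D 0 (z - d 0 w) = 0.
  by rewrite raddfB wE z'E subrr.
have edw : e (d 0 w) = 0 by apply/e_exact; exists w.
by exists (e w'); rewrite -eD w'E raddfB edw subr0.
Qed.

End FiniteResolution.

(** * The differential module of a module over the category *)

Definition f12 : @mor category_A a1 a2 := exist _ lf isT.
Definition g12 : @mor category_A a1 a2 := exist _ lg isT.
Definition f21 : @mor category_A a2 a1 := exist _ lf isT.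
Definition g21 : @mor category_A a2 a1 := exist _ lg isT.
Definition f24 : @mor category_A a2 a4 := exist _ lf isT.
Definition g24 : @mor category_A a2 a4 := exist _ lg isT.
Definition f31 : @mor category_A a3 a1 := exist _ lf isT.
Definition f32 : @mor category_A a3 a2 := exist _ lf isT.

Section Total.
Variable R : comNzRingType.
Implicit Types M N : rmodule R category_A.
Local Notation repA := (@rep_rmod R category_A).

Definition act_diff M (i j : category_A) (q q' : mor i j) (m : M j) : M i :=
  act M q m - act M q' m.
Arguments act_diff : simpl never.

Fact act_diff_is_zmod_morphism M (i j : category_A) (q q' : mor i j) :
  zmod_morphism (@act_diff M i j q q').
Proof.
move=> m n; rewrite /act_diff (raddfB (act M q)) (raddfB (act M q')).
by rewrite !opprD !opprK addrACA.
Qed.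
HB.instance Definition _ M (i j : category_A) (q q' : mor i j) :=
  GRing.isZmodMorphism.Build (M j) (M i) (act_diff q q')
    (@act_diff_is_zmod_morphism M i j q q').

Definition total M : lmodType R :=
  (M a1 * M a2 * M a3 * M a3 * M a4)%type.

Definition total_d M (z : total M) : total M :=
  let: (m1, m2, _, _, m4) := z in
  (act_diff g12 f12 m2,
   act_diff g21 f21 m1 + act_diff g24 f24 m4,
   act M f31 m1, act M f32 m2, 0).

Fact total_d_is_zmod_morphism M : zmod_morphism (@total_d M).
Proof.
move=> [[[[m1 m2] m3] m3'] m4] [[[[n1 n2] n3] n3'] n4].
congr (_, _, _, _, _);
  rewrite /= ?(raddfB (act_diff _ _)) ?(raddfB (act _ _)) ?subrr //.
by rewrite addrACA -opprD.
Qed.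
HB.instance Definition _ M :=
  GRing.isZmodMorphism.Build (total M) (total M) (@total_d M)
    (@total_d_is_zmod_morphism M).

Lemma act_act_diff M (i j k : category_A) (q q' : mor j k) (p : mor i j)
    (m : M k) :
  val (compm q p) = val (compm q' p) -> act M p (act_diff q q' m) = 0.
Proof. by move=> /val_inj E; rewrite raddfB /= -!act_comp E subrr. Qed.

Lemma act_diff_act_diff M (i j k : category_A) (q q' : mor j k)
    (p p' : mor i j) (m : M k) :
  val (compm q p) = val (compm q' p) -> val (compm q p') = val (compm q' p') ->
  act_diff p p' (act_diff q q' m) = 0.
Proof. by move=> E E'; rewrite {1}/act_diff !act_act_diff ?subrr. Qed.

Lemma total_dd M z : total_d (@total_d M z) = 0.
Proof.
case: z => [[[[m1 m2] m3] m3'] m4] /=.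
rewrite (raddfD (act_diff _ _)) (raddfD (act M f32)) raddf0 /=.
by rewrite !(act_diff_act_diff, act_act_diff) // !addr0.
Qed.

Definition total_map M N (u : rmod_hom M N) (z : total M) : total N :=
  let: (m1, m2, m3, m3', m4) := z in
  (u a1 m1, u a2 m2, u a3 m3, u a3 m3', u a4 m4).

Fact total_map_is_zmod_morphism M N (u : rmod_hom M N) :
  zmod_morphism (total_map u).
Proof.
move=> [[[[m1 m2] m3] m3'] m4] [[[[n1 n2] n3] n3'] n4].
by rewrite /total_map /= !raddfB.
Qed.
HB.instance Definition _ M N (u : rmod_hom M N) :=
  GRing.isZmodMorphism.Build (total M) (total N) (total_map u)
    (total_map_is_zmod_morphism u).

Lemma total_map_d M N (u : rmod_hom M N) z :
  total_map u (total_d z) = total_d (total_map u z).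
Proof.
case: z => [[[[m1 m2] m3] m3'] m4].
by rewrite /= !raddfD !raddfN /= raddf0 !hom_nat.
Qed.

Lemma total_map_epi M N (u : rmod_hom M N) :
  rmod_epi u -> forall y, exists z, total_map u z = y.
Proof.
move=> uP [[[[n1 n2] n3] n3'] n4].
have [[m1 <-] [m2 <-]] := (uP _ n1, uP _ n2).
have [[[m3 <-] [m3' <-]] [m4 <-]] := (uP _ n3, uP _ n3', uP _ n4).
by exists (m1, m2, m3, m3', m4).
Qed.

Lemma total_map_exact L M N (u : rmod_hom L M) (v : rmod_hom M N) :
  rmod_exact u v ->
  forall z, total_map v z = 0 <-> exists w, total_map u w = z.
Proof.
move=> uvP [[[[m1 m2] m3] m3'] m4]; split; last first.
  move=> [[[[[l1 l2] l3] l3'] l4] [E1 E2 E3 E3' E4]].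
  by congr (_, _, _, _, _); apply/uvP; eexists; eassumption.
case=> /uvP[l1 <-] /uvP[l2 <-] /uvP[l3 <-] /uvP[l3' <-] /uvP[l4 <-].
by exists (l1, l2, l3, l3', l4).
Qed.

Lemma total_const_not_acyclic : ~ acyclic (@total_d (const_rmod R category_A)).
Proof.
move=> ac; have [|[[[[w1 w2] w3] w3'] w4]] := ac (0, 0, 0, 0, 1).
  by rewrite /total_d /act_diff /= !subrr addr0.
by case=> _ _ _ _ /eqP; rewrite eq_sym oner_eq0.
Qed.

(** * Direct sums *)

Definition total_pair M N (z : total M) (w : total N) :
    total (dsum_rmod M N) :=
  let: (m1, m2, m3, m3', m4) := z in let: (n1, n2, n3, n3', n4) := w in
  ((m1, n1), (m2, n2), (m3, n3), (m3', n3'), (m4, n4)).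

Lemma total_pair_d M N (z : total M) (w : total N) :
  total_d (total_pair z w) = total_pair (total_d z) (total_d w).
Proof. by move: z w => [[[[? ?] ?] ?] ?] [[[[? ?] ?] ?] ?]. Qed.

Lemma total_pair_inj M N (z z' : total M) (w w' : total N) :
  total_pair z w = total_pair z' w' -> z = z' /\ w = w'.
Proof.
move: z z' w w' => [[[[? ?] ?] ?] ?] [[[[? ?] ?] ?] ?].
by move=> [[[[? ?] ?] ?] ?] [[[[? ?] ?] ?] ?] [*]; subst.
Qed.

Lemma total_pair_onto M N (t : total (dsum_rmod M N)) :
  exists z w, t = total_pair z w.
Proof.
case: t => [[[[[m1 n1] [m2 n2]] [m3 n3]] [m3' n3']] [m4 n4]].
by exists (m1, m2, m3, m3', m4), (n1, n2, n3, n3', n4).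
Qed.

Lemma acyclic_dsum M N :
  acyclic (@total_d (dsum_rmod M N)) <->
  acyclic (@total_d M) /\ acyclic (@total_d N).
Proof.
have pair0 : 0 = total_pair 0 0 :> total (dsum_rmod M N) by [].
split=> [ac | [acM acN] t].
  split=> z Dz.
    have [|t] := ac (total_pair z 0); first by rewrite total_pair_d Dz raddf0.
    have [w [w' ->]] := total_pair_onto t.
    by rewrite total_pair_d => /total_pair_inj[wE _]; exists w.
  have [|t] := ac (total_pair 0 z); first by rewrite total_pair_d Dz raddf0.
  have [w [w' ->]] := total_pair_onto t.
  by rewrite total_pair_d => /total_pair_inj[_ wE]; exists w'.
have [z [w ->]] := total_pair_onto t.
rewrite total_pair_d pair0 => /total_pair_inj[/acM[z' <-] /acN[w' <-]].
by exists (total_pair z' w'); rewrite total_pair_d.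
Qed.

(** * Coordinates in the modules R mor(?, j) *)

(** Coefficients are indexed by labels instead of morphisms, so that the
    action of a concrete morphism is found by computing with labels, without
    membership proofs. *)
Definition coef (i j : category_A) (m : repA j i) (l : label) : R :=
  if insub l is Some u then (m : {malg R[mor i j]})@_u else 0.

Lemma coef_val (i j : category_A) (m : repA j i) (u : mor i j) :
  coef m (val u) = (m : {malg R[mor i j]})@_u.
Proof. by rewrite /coef valK. Qed.

Lemma coef_ext (i j : category_A) (m n : repA j i) :
  {in labels i j, coef m =1 coef n} -> m = n.
Proof. by move=> mn; apply/malgP => u; rewrite -!coef_val mn ?(valP u). Qed.

Lemma coefB (i j : category_A) (m n : repA j i) l :
  coef (m - n) l = coef m l - coef n l.
Proof.
rewrite /coef; case: insubP => [u _ _ | _]; last by rewrite subrr.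
exact: mcoeffB.
Qed.

Lemma coef0 (i j : category_A) l : coef (0 : repA j i) l = 0.
Proof. by rewrite -[0](subrr 0) coefB subrr. Qed.

Lemma coefD (i j : category_A) (m n : repA j i) l :
  coef (m + n) l = coef m l + coef n l.
Proof. by apply/eqP; rewrite -subr_eq -coefB addrK. Qed.

Lemma labels_uniq i j : uniq (labels i j).
Proof. by case: i j => [] []. Qed.

Definition mors (i j : category_A) : seq (mor i j) := pmap insub (labels i j).

Lemma mors_uniq i j : uniq (mors i j).
Proof. by apply: pmap_sub_uniq; apply: labels_uniq. Qed.

Lemma mem_mors i j (u : mor i j) : u \in mors i j.
Proof. by rewrite mem_pmap_sub (valP u). Qed.

(** The range of the sum is a filtered list, not a filtered range, so that it
    evaluates to an explicit list for concrete arguments. *)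
Lemma coef_act (h i j : category_A) (p : mor h i) (m : repA j i) l :
  l \in labels h j ->
  coef (act (repA j) p m) l =
  \sum_(k <- [seq k <- labels i j | comp_label h j k (val p) == l]) coef m k.
Proof.
move=> hl; pose v : mor h j := Sub l hl.
have -> : l = val v by [].
rewrite coef_val /= (@rep_actEw _ _ _ _ _ _ _ [fset u in mors i j]%fset).
  rewrite raddf_sum /= (perm_big (mors i j)) /=; last first.
    by apply: uniq_perm (mors_uniq i j) _ => // u; rewrite !inE mem_mors.
  rewrite big_pmap big_filter [RHS]big_mkcond; apply: eq_big_seq => k hk.
  rewrite /coef (insubT (fun k => k \in labels i j) hk) /=.
  by rewrite mcoeffZ mcoeffU -val_eqE /=; case: eqP; rewrite ?mulr1 ?mulr0.
by apply/fsubsetP => u _; rewrite !inE mem_mors.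
Qed.

Lemma coef_act_diff (h i j : category_A) (p p' : mor h i) (m : repA j i) l :
  l \in labels h j ->
  coef (act_diff p p' m) l =
  \sum_(k <- [seq k <- labels i j | comp_label h j k (val p) == l]) coef m k -
  \sum_(k <- [seq k <- labels i j | comp_label h j k (val p') == l]) coef m k.
Proof.
move=> hl; rewrite /act_diff coefB.
by congr (_ - _); apply: coef_act.
Qed.

Lemma coef_onto (i j : category_A) (c : label -> R) :
  {m : repA j i | {in labels i j, coef m =1 c}}.
Proof.
exists (\sum_(u <- mors i j) << c (val u) *g u >>) => l hl.
pose v : mor i j := Sub l hl; have -> : l = val v by [].
rewrite coef_val raddf_sum (bigD1_seq v (mem_mors v) (mors_uniq i j)) /=.
rewrite mcoeffUU big1 ?addr0 // => u uv.
by rewrite mcoeffU (negPf uv).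
Qed.

Definition lift (i j : category_A) (c : label -> R) : repA j i :=
  sval (coef_onto i j c).
Arguments lift {i j} c.

Lemma coef_lift (i j : category_A) (c : label -> R) l :
  l \in labels i j -> coef (lift (i := i) (j := j) c) l = c l.
Proof. exact: (svalP (coef_onto i j c)). Qed.

(** * Contracting homotopies for the modules R mor(?, x) *)

(** Compares coefficients: the composition table turns both sides into linear
    expressions in the coefficients of the argument. *)
Ltac rep_homotopy :=
  move=> [[[[m1 m2] m3] m3'] m4]; rewrite /total_d;
  congr (_, _, _, _, _); apply: coef_ext => -[] // _;
  rewrite !(coef_act_diff, coef_act, coef_lift, coefD, coef0) //;
  rewrite ![filter _ _]/= ?(big_cons, big_nil);
  rewrite ?coef_lift //; cbn -[coef]; ring.

(** Since a3 is a retract of a1, R mor(?, a1) is the sum of R mor(?, a3) and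
    the module T spanned by id - f11 at a1 and g21 - f21 at a2. On T the
    component g21 - f21 of the differential is bijective, and its inverse
    reads off the coefficient of g21; the entries with m3 and m3' invert f31
    and f32. *)
Definition rep1_homotopy (z : total (repA a1)) : total (repA a1) :=
  let: (m1, m2, m3, m3', m4) := z in
  (lift (fun l => if l is lid then coef m2 lg else coef m3 lf - coef m2 lg),
   lift (fun l => if l is lf then coef m3' lf else 0), 0, 0, 0).

Lemma rep1_homotopyP z :
  total_d (rep1_homotopy z) + rep1_homotopy (total_d z) = z.
Proof. by move: z; rep_homotopy. Qed.

(** The same with a1 and a2 exchanged: now g12 - f12 is inverted. *)
Definition rep2_homotopy (z : total (repA a2)) : total (repA a2) :=
  let: (m1, m2, m3, m3', m4) := z in
  (lift (fun l => if l is lf then coef m3 lf else 0),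
   lift (fun l => if l is lid then coef m1 lg else coef m3' lf - coef m1 lg),
   0, 0, 0).

Lemma rep2_homotopyP z :
  total_d (rep2_homotopy z) + rep2_homotopy (total_d z) = z.
Proof. by move: z; rep_homotopy. Qed.

(** Here f31 and f32 act bijectively and the three differences act by 0. *)
Definition rep3_homotopy (z : total (repA a3)) : total (repA a3) :=
  let: (m1, m2, m3, m3', m4) := z in
  (lift (fun=> coef m3 lid), lift (fun=> coef m3' lid), 0, 0, 0).

Lemma rep3_homotopyP z :
  total_d (rep3_homotopy z) + rep3_homotopy (total_d z) = z.
Proof. by move: z; rep_homotopy. Qed.

(** Modulo the copy of R mor(?, a3) embedded by f34, what is left of
    R mor(?, a4) is spanned by the identity of a4 and g24 - f24 at a2. The
    differential sends the former to the latter, and the last entry inverts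
    this. *)
Definition rep4_homotopy (z : total (repA a4)) : total (repA a4) :=
  let: (m1, m2, m3, m3', m4) := z in
  (lift (fun=> coef m3 lf),
   lift (fun l => if l is lf then coef m3' lf else 0), 0, 0,
   lift (fun=> coef m2 lg)).

Lemma rep4_homotopyP z :
  total_d (rep4_homotopy z) + rep4_homotopy (total_d z) = z.
Proof. by move: z; rep_homotopy. Qed.

(** * Projective modules *)

Lemma acyclic_rep x : acyclic (@total_d (repA x)).
Proof.
case: x; [exact: (acyclic_homotopy rep1_homotopyP)
  | exact: (acyclic_homotopy rep2_homotopyP)
  | exact: (acyclic_homotopy rep3_homotopyP)
  | exact: (acyclic_homotopy rep4_homotopyP)].
Qed.

Lemma acyclic_free (s : seq category_A) :
  acyclic (@total_d (fg_free_rmod R s)).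
Proof.
elim: s => [|x s IHs] /=.
  move=> [[[[m1 m2] m3] m3'] m4] _; exists 0; rewrite raddf0.
  by congr (_, _, _, _, _); rewrite [RHS]thinmx0.
by apply/acyclic_dsum; split=> //; apply: acyclic_rep.
Qed.

Lemma acyclic_projective P : fg_projective P -> acyclic (@total_d P).
Proof.
move=> [Q [s [u [v uv]]]].
suff /acyclic_dsum[] : acyclic (@total_d (dsum_rmod P Q)) by [].
have uK : cancel (total_map u) (total_map v).
  by case=> [[[[m1 m2] m3] m3'] m4]; rewrite /= !(uv _).1.
apply: (@acyclic_retract (total (dsum_rmod P Q)) (total (fg_free_rmod R s))
  _ _ (total_map u) (total_map v)).
- exact: total_map_d.
- exact: total_map_d.
- exact: uK.
- exact: acyclic_free.
Qed.

End Total.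

Theorem theorem10p2 (R : comNzRingType) : ~ type_FP R category_A.
Proof.
move=> [P [d [e [projP [N PN] e_epi e_ex d_ex]]]].
apply: (@total_const_not_acyclic R).
apply: (@acyclic_resolved (fun n => total (P n)) _
  (fun n => @total_d R (P n)) _ (fun n => total_map (d n)) (total_map e)).
- by move=> n z; exact: total_dd.
- by move=> n z; exact: total_map_d.
- by move=> z; exact: total_map_d.
- exact: total_map_epi.
- exact: total_map_exact.
- by move=> n; exact: total_map_exact.
- exists N => n leNn [[[[m1 m2] m3] m3'] m4].
  by congr (_, _, _, _, _); apply: PN.
- by move=> n; apply: acyclic_projective.
Qed.
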